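(* There is a deterministic adaptive algorithm and a function $f:\mathbb{N}\times\mathbb{N}\to\mathbb{N}$ with the following property. Let $G=(V,E)$ be a hidden connected graph with $n\ge 2$ vertices and maximum degree $\Delta$, let $\tau$ be an integer with $\tau\ge \mathrm{tl}(G)$, and suppose the algorithm is given $V$ and $\tau$ together with access to a shortest-path distance oracle for $G$. Then the algorithm determines $E$ exactly, using at most $f(\Delta,\tau)\cdot n\log n$ oracle queries. (The paper states the bound as $O(\Delta^{3\tau+2}\cdot n\log n)$, treating $\Delta$ and $\tau$ as constants.)
   Context: All graphs are simple, unweighted, undirected and connected. Shortest-path distance oracle: given $u,v\in V$ it returns $d_G(u,v)$, the length of a shortest $u$-$v$ path in $G$; each such call counts as one query, and queries may be chosen adaptively. The algorithm knows only $V$ and $\tau$ initially; reconstruction is complete when $E$ is determined. A tree decomposition of $G$ is a pair $(T,\{V_t\}_{t\in V(T)})$ with $T$ a tree and $V_t\subseteq V$ such that every vertex lies in some bag, every edge has both endpoints in some bag, and for each vertex $v$ the set of $t$ with $v\in V_t$ induces a connected subtree of $T$. The treelength $\mathrm{tl}(G)$ is the minimum over tree decompositions of $\max_t\max_{u,v\in V_t} d_G(u,v)$. *)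

(* Defs.v *)
From mathcomp Require Import all_boot.
Set Implicit Arguments. Unset Strict Implicit. Unset Printing Implicit Defensive.

Definition simple_connected_graph (V : finType) (e : rel V) : Prop :=
  [/\ symmetric e, irreflexive e & forall u v : V, connect e u v].

(** Shortest-path distance d_G(u,v): least k such that there is a walk of
    length k from u to v (walks of length < #|V| suffice in a connected graph;
    returns #|V| if v is unreachable, which never happens for connected G). *)
Definition dist (V : finType) (e : rel V) (u v : V) : nat :=
  find (fun k => [exists p : k.-tuple V, path e u p && (last u p == v)])
       (iota 0 #|V|).

Definition maxdeg (V : finType) (e : rel V) : nat :=
  \max_(v : V) #|[set w | e v w]|.

Definition is_tree (T : finType) (t : rel T) : Prop :=
  [/\ symmetric t, irreflexive t, (forall x y : T, connect t x y)
    & forall s : seq T, uniq s -> 2 < size s -> ~~ cycle t s].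

Definition tree_decomposition (V : finType) (e : rel V)
    (T : finType) (t : rel T) (bag : T -> {set V}) : Prop :=
  [/\ is_tree t,
      (forall v : V, exists x : T, v \in bag x),
      (forall u v : V, e u v -> exists x : T, (u \in bag x) && (v \in bag x))
    & forall (v : V) (x y : T), v \in bag x -> v \in bag y ->
        connect [rel a b | [&& t a b, v \in bag a & v \in bag b]] x y].

(** tl(G) <= tau : some tree decomposition has all bag diameters <= tau
    (tl(G) is the minimum over decompositions of the max bag diameter). *)
Definition treelength_le (V : finType) (e : rel V) (tau : nat) : Prop :=
  exists (T : finType) (t : rel T) (bag : T -> {set V}),
    tree_decomposition e t bag /\
    forall (x : T) (u v : V), u \in bag x -> v \in bag x -> dist e u v <= tau.

(** Deterministic adaptive query algorithms on vertex set 'I_n, as decision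
    trees: either stop and output an edge relation, or query the oracle on a
    pair (u,v) and continue according to the answer. *)
Inductive QTree (n : nat) : Type :=
  | Leaf of rel 'I_n
  | Ask of 'I_n & 'I_n & (nat -> QTree n).

Fixpoint run (n : nat) (A : QTree n) (oracle : 'I_n -> 'I_n -> nat)
  : rel 'I_n * nat :=
  match A with
  | Leaf E => (E, 0)
  | Ask u v k => let r := run (k (oracle u v)) oracle in (r.1, r.2.+1)
  end.

(* Main.v *)
(** A vertex [y] lies on a geodesic from the root to [v] iff
    [d(r,y) + d(y,v) = d(r,v)], so one query decides whether some parent of [v]
    in the breadth-first layering is a geodesic descendant of [y].  Bounded
    degree always provides a [y] whose descendants split the candidate parents
    in proportion at least [1/(2 Delta)], so one parent [p] of [v] is found with
    [O(Delta log n)] queries.  Bounded treelength makes the classes of the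
    layering partition have diameter at most [3 tau]; hence all earlier
    neighbours of [v] are within distance [9 tau + 1] of [p] in the part of the
    graph already known, and querying that ball reveals them. *)

Require Import Defs.
From mathcomp Require Import all_boot.
From mathcomp Require Import zify.

Set Implicit Arguments. Unset Strict Implicit. Unset Printing Implicit Defensive.

(** * Paths and graph distance *)

Lemma path_reversal (V : finType) (e : rel V) x p :
    symmetric e -> path e x p ->
  exists q, [/\ path e (last x p) q, last (last x p) q = x, size q = size p
               & {subset q <= x :: p}].
Proof.
move=> e_sym ep; exists (rev (belast x p)); split.
- by rewrite rev_path (eq_path (e' := e)) // => y z; exact: e_sym.
- by case: (p) => //= y p'; rewrite rev_cons last_rcons.
- by rewrite size_rev size_belast.
- by move=> z; rewrite mem_rev => /mem_belast.
Qed.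

Section Distance.
Variables (V : finType) (e : rel V).

Lemma dist_le_path u p : path e u p -> dist e u (last u p) <= size p.
Proof.
(* A path with at least [#|V|] edges is covered by the default value: [find] never exceeds the
   length of the list. *)
move=> ep; have [lt_p|le_p] := ltnP (size p) #|V|; last first.
  apply: leq_trans le_p; rewrite /dist.
  by rewrite -[X in _ <= X](size_iota 0) find_size.
rewrite leqNgt; apply/negP => /(before_find 0)/negbT.
rewrite nth_iota // add0n /= => /negP; apply.
by apply/existsP; exists (in_tuple p); rewrite ep eqxx.
Qed.

Lemma distxx u : dist e u u = 0.
Proof. by have := @dist_le_path u [::] isT; rewrite leqn0 => /eqP. Qed.

Hypothesis e_conn : forall u v, connect e u v.

Lemma dist_path u v :
  exists p, [/\ path e u p, last u p = v & size p = dist e u v].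
Proof.
have hasP : has (fun k => [exists p : k.-tuple V, path e u p && (last u p == v)])
                (iota 0 #|V|).
  have /connectP[p ep ->] := e_conn u v.
  have [p' ep' Up' _] := shortenP ep.
  apply/hasP; exists (size p'); last first.
    by apply/existsP; exists (in_tuple p'); rewrite ep' eqxx.
  rewrite mem_iota add0n /= -[_ < _]/(size (u :: p') <= _).
  by rewrite -(card_uniqP Up') max_card.
have := nth_find 0 hasP; rewrite -/(dist e u v).
rewrite nth_iota; last by rewrite -[X in _ < X](size_iota 0) -has_find.
rewrite add0n /= => /existsP[p /andP[ep /eqP lp]].
by exists p; rewrite size_tuple.
Qed.

Lemma dist_triangle u v w : dist e u w <= dist e u v + dist e v w.
Proof.
have [p [ep <- <-]] := dist_path u v.
have [q [eq <- <-]] := dist_path (last u p) w.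
by rewrite -last_cat -size_cat dist_le_path // cat_path ep.
Qed.

Lemma dist_eq0 u v : dist e u v = 0 -> u = v.
Proof. by have [[|x p] [_ <- <-]] := dist_path u v. Qed.

Hypothesis e_irr : irreflexive e.

Lemma dist_eq1 u v : (dist e u v == 1) = e u v.
Proof.
apply/eqP/idP => [|euv].
  by have [[|x [|y p]] [/= ep <- <-]] := dist_path u v => //; case/andP: ep.
have le1 : dist e u v <= 1 by apply: (@dist_le_path u [:: v]); rewrite /= euv.
case: (dist e u v) (@dist_eq0 u v) le1 => [/(_ erefl) uv|[]//].
by rewrite uv e_irr in euv.
Qed.

Hypothesis e_sym : symmetric e.

Lemma dist_sym u v : dist e u v = dist e v u.
Proof.
suff le a b : dist e a b <= dist e b a by apply/eqP; rewrite eqn_leq !le.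
have [p [ep <- <-]] := dist_path b a.
have [q [eq lq sq _]] := path_reversal e_sym ep.
by rewrite -[X in dist e _ X]lq -sq dist_le_path.
Qed.

End Distance.

(** * Subtrees of a tree and their Helly property *)

Section Tree.
Variables (T : finType) (t : rel T).

Definition connected_set (F : {set T}) :=
  forall x y, x \in F -> y \in F ->
    connect [rel a b | [&& t a b, a \in F & b \in F]] x y.

Hypothesis t_sym : symmetric t.
Hypothesis t_irr : irreflexive t.
Hypothesis t_acyclic : forall s, uniq s -> 2 < size s -> ~~ cycle t s.

(** If every vertex of [W] had two neighbours in [W], a simple path in [W] could be extended at its
    head forever: by acyclicity only one of the two can already lie on the path. Length [#|T|] is
    then absurd. *)
Lemma exists_leaf (W : {set T}) (x0 : T) : x0 \in W ->
  exists2 l, l \in W & {in W &, forall a b, t l a -> t l b -> a = b}.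
Proof.
move=> Wx0.
have [/existsP[l /andP[Wl /forall_inP leaf]]|no_leaf] :=
    boolP [exists l, (l \in W) &&
             [forall a in W, [forall b in W, t l a ==> t l b ==> (a == b)]]].
  exists l => // a b Wa Wb la lb; apply/eqP.
  by have /forall_inP/(_ b Wb) := leaf a Wa; rewrite la lb.
suff long k : exists x p,
    [/\ size p = k, uniq (x :: p), path t x p & all [in W] (x :: p)].
  have [x [p [sp /card_uniqP Up _ _]]] := long #|T|.
  by have := max_card (mem (x :: p)); rewrite Up /= sp ltnn.
elim: k => [|k [x [p [sp Up tp Wp]]]]; first by exists x0, [::]; rewrite /= Wx0.
have /andP[Wx _] := Wp.
have [y Wy /andP[xy py]] : exists2 y, y \in W & t x y && (y \notin p).
  have : ~~ [forall a in W, [forall b in W, t x a ==> t x b ==> (a == b)]].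
    by apply: contra no_leaf => H; apply/existsP; exists x; rewrite Wx.
  case/forall_inPn => a Wa /forall_inPn[b Wb]; rewrite !negb_imply => /and3P[xa xb ab].
  have [pa|] := boolP (a \in p); last by exists a; rewrite ?xa.
  have [pb|] := boolP (b \in p); last by exists b; rewrite ?xb.
  exfalso.
  have noc c : t x c -> c \in p -> c = head x p.
    move=> xc pc; case/splitPr: p / pc {sp Wp pa pb} Up tp => p1 p2.
    case: p1 => [//|z p1] Up tp; exfalso.
    move: Up tp; rewrite -cat_rcons -cat_cons cat_path cat_uniq.
    move=> /andP[Uc _] /andP[tc _].
    have := t_acyclic Uc; rewrite /= size_rcons => /(_ isT)/negP; apply.
    by move: tc => /= /andP[-> tc]; rewrite rcons_path tc last_rcons t_sym.
  by rewrite (noc a) // (noc b) ?eqxx in ab.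
exists y, (x :: p); split; rewrite //= ?sp //.
- rewrite inE negb_or py andbT; apply/andP; split=> //.
  by apply: contraTneq xy => ->; rewrite t_irr.
- by rewrite t_sym xy.
- by rewrite Wy.
Qed.

Lemma uniq_path_in (F : {set T}) x y :
    x \in F -> connect [rel a b | [&& t a b, a \in F & b \in F]] x y ->
  exists p, [/\ path t x p, uniq (x :: p), all [in F] p & last x p = y].
Proof.
move=> Fx /connectP[p0 tp0 ->]; have [p tp Up _] := shortenP tp0.
exists p; split=> //; first by apply: sub_path tp => a b /andP[].
apply/allP=> z pz; case/splitPr: p / pz {Up} tp => p1 p2.
by rewrite cat_path /= => /and3P[_ /and3P[]].
Qed.

Lemma path_in_connect (F : {set T}) x p :
    x \in F -> path t x p -> all [in F] p ->
  connect [rel a b | [&& t a b, a \in F & b \in F]] x (last x p).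
Proof.
move=> Fx tp Fp; apply/connectP; exists p => //.
elim: p x Fx tp Fp => //= y p IHp x Fx /andP[-> tp] /andP[Fy Fp].
by rewrite Fx Fy IHp.
Qed.

(** A simple path through [l] would enter and leave it by two different neighbours in [W], so simple
    paths in [F] between other vertices avoid [l]. *)
Lemma connected_setD1 (W F : {set T}) l :
    {in W &, forall a b, t l a -> t l b -> a = b} -> F \subset W ->
  connected_set F -> connected_set (F :\ l).
Proof.
move=> leaf sFW cF x y Dx Dy; have [xl Fx] := setD1P Dx; have [yl Fy] := setD1P Dy.
have [p [tp Up Fp yp]] := uniq_path_in Fx (cF x y Fx Fy).
suff lp : l \notin p.
  rewrite -yp; apply: path_in_connect => //; apply/allP => z pz.
  by rewrite !inE (allP Fp) // andbT; apply: contraNneq lp => <-.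
apply/negP => pl; case/splitPr: p / pl tp Up Fp yp => p1 [|z p2].
  by rewrite last_cat /= => _ _ _ ly; rewrite ly eqxx in yl.
rewrite cat_path -cat_cons cat_uniq all_cat.
move=> /andP[_ /and3P[lpl lz _]] /and3P[_ /hasPn nz _] /andP[Fp1 /and3P[Fl Fz _]] _.
have Fw : last x p1 \in F.
  by have := mem_last x p1; rewrite inE => /predU1P[->|/(allP Fp1)].
have /nz/negP[] : z \in [:: l, z & p2] by rewrite !inE eqxx orbT.
rewrite /= (leaf z (last x p1)) ?(subsetP sFW) // ?mem_last //.
by rewrite t_sym.
Qed.

Lemma connected_set_nbr (F : {set T}) l :
  connected_set F -> l \in F -> F != [set l] -> exists2 a, a \in F & t l a.
Proof.
move=> cF Fl nF; have [y Fy yl] : exists2 y, y \in F & y != l.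
  apply/exists_inP; rewrite -negb_forall_in; apply: contra nF => /forall_inP H.
  rewrite eqEsubset sub1set Fl andbT; apply/subsetP=> y /H/eqP->.
  exact: set11.
have [[|a p] [/= tp _ Fp yp]] := uniq_path_in Fl (cF l y Fl Fy).
  by rewrite yp eqxx in yl.
by case/andP: tp Fp => la _ /andP[Fa _]; exists a.
Qed.

(** Leaf removal, by induction on a set [W] containing all members. If [[set l]] is a member, [l] is
    common to all. Otherwise [l] is deleted from every member; two members that met at [l] still
    meet, since both contain the unique neighbour of [l] in [W]. The case [F = F'] makes members
    nonempty; [x0] serves the empty family. *)
Lemma helly (x0 : T) (fam : seq {set T}) :
    (forall F, F \in fam -> connected_set F) ->
    (forall F F', F \in fam -> F' \in fam -> F :&: F' != set0) ->
  exists x, forall F, F \in fam -> x \in F.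
Proof.
pose W := [set: T]; have sW F : F \in fam -> F \subset W.
  by move=> _; exact: subsetT.
move: {2}#|W| (leqnn #|W|) => m.
elim: m W fam sW => [|m IHm] W fam sW leWm cfam ifam.
  exists x0 => F famF; have := ifam F F famF famF.
  rewrite setIid; case/set0Pn => z /(subsetP (sW F famF)) Wz.
  by move: leWm; rewrite leqNgt card_gt0; case/set0Pn; exists z.
have [W0|[w Ww]] := set_0Vmem W.
  by apply: (IHm W) => //; rewrite W0 cards0.
have [l Wl leaf] := exists_leaf Ww.
have [fl|nfl] := boolP ([set l] \in fam).
  exists l => F famF; case/set0Pn: (ifam F _ famF fl) => z.
  by rewrite !inE => /andP[Fz /eqP <-].
have D1 F : F \in fam -> F != [set l] by apply: contraTneq => ->.
have [||F' /mapP[F famF ->]|F1' F2' /mapP[F1 fam1 ->] /mapP[F2 fam2 ->]|x Hx] :=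
  IHm (W :\ l) [seq F :\ l | F : {set T} <- fam].
- by move=> F' /mapP[F famF ->]; rewrite setSD ?sW.
- by move: leWm; rewrite (cardsD1 l) Wl.
- by apply: connected_setD1 (cfam F famF); [exact: leaf | exact: sW].
- have [z /setIP[F1z F2z]] := set0Pn _ (ifam _ _ fam1 fam2).
  have [zl|zl] := eqVneq z l; last by apply/set0Pn; exists z; rewrite !inE zl F1z.
  have [|a F1a la] := connected_set_nbr (cfam _ fam1) _ (D1 _ fam1); first by rewrite -zl.
  have [|b F2b lb] := connected_set_nbr (cfam _ fam2) _ (D1 _ fam2); first by rewrite -zl.
  have ab : a = b.
    by apply: leaf => //; [apply: subsetP F1a | apply: subsetP F2b]; exact: sW.
  apply/set0Pn; exists a; rewrite !inE F1a ab F2b -ab andbT andbb.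
  by have -> : a != l by apply: contraTneq la => ->; rewrite t_irr.
exists x => F famF; have := Hx _ (map_f (fun F : {set T} => F :\ l) famF).
by case/setD1P.
Qed.

End Tree.

(** * Tree decompositions and the bags met by paths *)

Section Decomposition.
Variables (T : finType) (t : rel T).

Lemma connected_setU (A B : {set T}) :
    connected_set t A -> connected_set t B -> A :&: B != set0 ->
  connected_set t (A :|: B).
Proof.
move=> cA cB /set0Pn[z /setIP[Az Bz]].
have sub (C : {set T}) : connected_set t C -> C \subset A :|: B ->
    {in C &, forall x y,
      connect [rel a b | [&& t a b, a \in A :|: B & b \in A :|: B]] x y}.
  move=> cC /subsetP sC x y Cx Cy.
  apply: connect_sub (cC x y Cx Cy) => a b /and3P[ab Ca Cb].
  by apply: connect1; rewrite /= ab !sC.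
have cA' := sub A cA (subsetUl A B); have cB' := sub B cB (subsetUr A B).
move=> x y /setUP[Ax|Bx] /setUP[Ay|By]; [exact: cA'| | |exact: cB'].
  by apply: connect_trans (cA' x z Ax Az) (cB' z y Bz By).
by apply: connect_trans (cB' x z Bx Bz) (cA' z y Az Ay).
Qed.

Variables (V : finType) (e : rel V) (bag : T -> {set V}).
Hypothesis dec : tree_decomposition e t bag.

(** Each vertex occupies a subtree, and consecutive vertices share a bag because they form an edge,
    so the union of these subtrees is connected. *)
Lemma path_bags_connected u p :
  path e u p -> connected_set t [set x | has [in bag x] (u :: p)].
Proof.
have [_ _ dec_edge dec_conn] := dec.
have single v : connected_set t [set x | v \in bag x].
  move=> x y; rewrite !inE => xv yv.
  apply: connect_sub (dec_conn v x y xv yv) => a b /and3P[ab va vb].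
  by apply: connect1; rewrite /= ab !inE va.
elim: p u => [|y p IHp] u /=.
  move=> _; rewrite (_ : [set x | _] = [set x | u \in bag x]); first exact: single.
  by apply/setP => x; rewrite !inE orbF.
move=> /andP[uy yp].
have -> : [set x | has [in bag x] (u :: y :: p)] =
          [set x | u \in bag x] :|: [set x | has [in bag x] (y :: p)].
  by apply/setP => x; rewrite !inE.
apply: connected_setU => //; first exact: IHp.
have [x /andP[xu xy]] := dec_edge u y uy.
by apply/set0Pn; exists x; apply/setIP; split; rewrite inE //= xy.
Qed.

(** Paths with a common vertex meet a common bag, so Helly applies to the three subtrees of bags
    meeting the paths. *)
Lemma three_paths_bag (x0 : T) u p v q w s :
    path e u p -> path e v q -> path e w s ->
    has [in u :: p] (v :: q) -> has [in v :: q] (w :: s) -> has [in u :: p] (w :: s) ->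
  exists x a b c,
    [/\ a \in u :: p, b \in v :: q & c \in w :: s] /\
    [/\ a \in bag x, b \in bag x & c \in bag x].
Proof.
have [[t_sym t_irr _ t_acyc] dec_vert _ _] := dec.
move=> ep eq es hpq hqs hps.
pose F r : {set T} := [set x | has [in bag x] r].
have meet r1 r2 : has [in r1] r2 -> F r1 :&: F r2 != set0.
  move=> /hasP[z r2z r1z]; have [x xz] := dec_vert z.
  by apply/set0Pn; exists x; apply/setIP; split; rewrite inE; apply/hasP; exists z.
have self y r : has [in y :: r] (y :: r) by rewrite /= mem_head.
have [||x Hx] := @helly T t t_sym t_irr t_acyc x0 [:: F (u :: p); F (v :: q); F (w :: s)].
- by move=> A; rewrite !inE => /or3P[]/eqP->; exact: path_bags_connected.
- move=> A B; rewrite !inE => /or3P[]/eqP-> /or3P[]/eqP->;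
    try exact: meet; rewrite setIC; exact: meet.
have [] := (Hx _ (mem_head _ _), Hx (F (v :: q)), Hx (F (w :: s))).
rewrite !inE !eqxx !orbT.
move=> -[/hasP[a pa xa]] /(_ isT)/hasP[b qb xb] /(_ isT)/hasP[c sc xc].
by exists x, a, b, c.
Qed.

End Decomposition.

(** * Layers around the root and the effect of bounded treelength *)

Section Layers.
Variables (V : finType) (e : rel V) (r : V).
Hypothesis e_graph : simple_connected_graph e.
Let e_sym : symmetric e. Proof. by case: e_graph. Qed.
Let e_irr : irreflexive e. Proof. by case: e_graph. Qed.
Let e_conn u v : connect e u v. Proof. by case: e_graph. Qed.
Local Notation d := (dist e r).

(** Generic in graph and rank: the algorithm has only the known subgraph and the answers to root
    queries, which the proof compares with [e] and [d]. *)
Definition upward (g : rel V) (rk : V -> nat) : rel V :=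
  [rel a b | g a b && (rk b == (rk a).+1)].
Local Notation up := (upward e d).

Lemma rank_edge a b : e a b -> d b <= (d a).+1.
Proof.
move=> ab; rewrite -addn1; apply: leq_trans (dist_triangle e_conn r a b) _.
by rewrite leq_add2l leq_eqVlt dist_eq1 ?ab.
Qed.

Lemma up_path_rank x p : path up x p -> d (last x p) = d x + size p.
Proof.
elim: p x => [|y p IHp] x /=; first by rewrite addn0.
by case/andP => /andP[_ /eqP dy] /IHp->; rewrite dy addSnnS.
Qed.

(** An upward path gains one layer per edge, hence is a geodesic. Conversely, if the length of a
    geodesic equals its gain in rank, it must rise by one along every edge. *)
Lemma connect_upE x v : connect up x v = (d x + dist e x v == d v).
Proof.
apply/connectP/eqP => [[p up_p ->]|dv].
  apply/eqP; rewrite eqn_leq dist_triangle // andbT (up_path_rank up_p) leq_add2l.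
  by apply: dist_le_path; apply: sub_path up_p => a b /andP[].
have [p [ep lp sp]] := dist_path e_conn x v.
exists p => //; move: dv; rewrite -sp -lp.
elim: p x ep {lp sp} => //= y p IHp x /andP[xy yp] dl.
have le_last q z : path e z q -> d (last z q) <= d z + size q.
  move=> zq; apply: leq_trans (dist_triangle e_conn r z _) _.
  by rewrite leq_add2l dist_le_path.
have /eqP dy : d y == (d x).+1.
  rewrite eqn_leq rank_edge //=; have := le_last p y yp; rewrite -dl; lia.
by rewrite /upward /= xy dy eqxx IHp //= dy addSnnS.
Qed.

Lemma connect_up_le x v : connect up x v -> d x <= d v.
Proof. by rewrite connect_upE => /eqP<-; exact: leq_addr. Qed.

Lemma connect_up_eq x v : connect up x v -> d v <= d x -> x = v.
Proof.
rewrite connect_upE => /eqP<- le; apply: (dist_eq0 e_conn); lia.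
Qed.

Lemma connect_up_root v : connect up r v.
Proof. by rewrite connect_upE distxx. Qed.

Lemma connect_up_parent x v : connect up x v -> x != v ->
  exists2 p, connect up x p & up p v.
Proof.
case/connectP => p; case: (lastP p) => [_ ->|{}p y]; first by rewrite eqxx.
rewrite rcons_path last_rcons => /andP[xp py] -> _.
by exists (last x p) => //; apply/connectP; exists p.
Qed.

Lemma exists_parent v : 0 < d v -> exists p, up p v.
Proof.
move=> dv; have [|p _ pv] := connect_up_parent (connect_up_root v); last by exists p.
by apply: contraTneq dv => <-; rewrite distxx.
Qed.

Lemma exists_ancestor v j : j <= d v -> exists2 a, connect up a v & d a = j.
Proof.
move: {2}(d v - j) (erefl (d v - j)) => k; elim: k v => [|k IHk] v dvj le_j.
  by exists v => //; lia.
have [|p pv] := @exists_parent v; first by lia.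
have /andP[_ /eqP dv] := pv.
have [||a ap da] := IHk p; [by lia|by lia|exists a => //].
exact: connect_trans ap (connect1 pv).
Qed.

Lemma up_path_mem x p z : path up x p -> z \in x :: p ->
  connect up x z /\ connect up z (last x p).
Proof.
move=> up_p /[dup] xz; case/splitPl: xz up_p => p1 p2 <-.
rewrite cat_path last_cat => /andP[up1 up2].
by split; apply/connectP; [exists p1 | exists p2].
Qed.

Lemma up_path_edge x p : path up x p -> path e x p.
Proof. by apply: sub_path => a b /andP[]. Qed.

Variable tau : nat.
Hypothesis tl : treelength_le e tau.

(* The classes of a layering partition have diameter at most [3 tau]: one bag
   meets both geodesics to the root and the path joining [u] and [w]. *)
Lemma layer_cluster u q :
    path e u q -> {in q, forall z, d u <= d z} -> d (last u q) = d u ->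
  dist e u (last u q) <= 3 * tau.
Proof.
have [T [t [bag [dec bag_tau]]]] := tl.
move=> eq dq; have := mem_last u q.
move: (last u q) => w qw dl.
have /connectP[pu up_u lu] := connect_up_root u.
have /connectP[pw up_w lw] := connect_up_root w.
have [_ dec_vert _ _] := dec; have [x0 _] := dec_vert u.
have [||| x [a [b [c [[ua wb qc] [xa xb xc]]]]]] := three_paths_bag dec x0
   (up_path_edge up_u) (up_path_edge up_w) eq.
- by rewrite /= mem_head.
- by apply/hasP; exists w => //; rewrite {1}lw /= mem_last.
- by apply/hasP; exists u; rewrite ?mem_head // {1}lu /= mem_last.
(* The bag also holds [c] on [q], with [d c >= d u], so [y] is at most [tau] layers closer to the
   root than [z]. As [y] is on a geodesic from the root to [z], this bounds their distance. *)
have near y p z : path up r p -> z = last r p -> y \in r :: p -> y \in bag x ->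
    d z = d u -> dist e y z <= tau.
  move=> up_p lz py xy dz; have [_] := up_path_mem up_p py.
  rewrite -lz connect_upE => /eqP dyz.
  have dc : d u <= d c by move: qc; rewrite inE => /predU1P[->|/dq].
  rewrite -(leq_add2l (d y)) dyz dz; apply: leq_trans dc _.
  apply: leq_trans (dist_triangle e_conn r y c) _.
  by rewrite leq_add2l; exact: bag_tau x y c xy xc.
have au := near a pu u up_u lu ua xa erefl.
have bw := near b pw w up_w lw wb xb dl.
have ab := bag_tau x a b xa xb.
rewrite !mulSn mul0n addn0; apply: leq_trans (dist_triangle e_conn u a w) _.
rewrite (dist_sym e_conn e_sym u a); apply: leq_add au _.
exact: leq_trans (dist_triangle e_conn a b w) (leq_add ab bw).
Qed.

(* Climb [3 tau] layers from both ends: the ancestors are [3 tau]-close by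
   [layer_cluster], so a geodesic between them does not reach beyond the layer
   of [p]. *)
Lemma low_path p q :
    path e p q -> {in q, forall z, d p <= d z} -> d (last p q) = d p ->
  exists l, [/\ path e p l, last p l = last p q, size l <= 9 * tau
              & {in l, forall z, d z <= d p}].
Proof.
move=> eq dq dl; set p' := last p q in dl *.
(* Truncated subtraction: if [d p < 3 * tau], both ancestors are the root and the geodesic between
   them is empty. *)
pose j := d p - 3 * tau; have le_j : j <= d p by exact: leq_subr.
have [a ap da] := exists_ancestor le_j.
have [|a' ap' da'] := @exists_ancestor p' j; first by rewrite dl.
have /connectP[s up_s ls] := ap; have /connectP[s' up_s' ls'] := ap'.
have [s1 [es1 ls1 ss1 sub1]] := path_reversal e_sym (up_path_edge up_s).
have [s2 [es2 ls2 ss2 sub2]] := path_reversal e_sym (up_path_edge up_s').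
rewrite -ls in es1 ls1; rewrite -ls' in es2 ls2.
have ds z : z \in a :: s -> j <= d z <= d p.
  move=> sz; have [/connect_up_le + /connect_up_le] := up_path_mem up_s sz.
  by rewrite da -ls => -> ->.
have ds' z : z \in a' :: s' -> j <= d z <= d p.
  move=> sz; have [/connect_up_le + /connect_up_le] := up_path_mem up_s' sz.
  by rewrite da' -ls' dl => -> ->.
(* [layer_cluster] at layer [j], for the walk from [a] to [p], along [q], then back to [a']. *)
have close : dist e a a' <= 3 * tau.
  have la' : last a (s ++ q ++ s2) = a' by rewrite !last_cat -ls -/p' ls2.
  rewrite -la'; apply: layer_cluster.
  - by rewrite !cat_path (up_path_edge up_s) -ls eq -/p' es2.
  - move=> z; rewrite !mem_cat da => /or3P[sz|/dq dz|/sub2/ds'/andP[]//].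
      by have /andP[] : j <= d z <= d p by rewrite ds // inE sz orbT.
    exact: leq_trans dz.
  - by rewrite la' da da'.
have root : d p < 3 * tau -> dist e a a' = 0.
  move=> lt_p; have j0 : j = 0 by rewrite /j; lia.
  rewrite -(dist_eq0 e_conn (etrans da j0)) -(dist_eq0 e_conn (etrans da' j0)).
  exact: distxx.
have [g [eg lg sg]] := dist_path e_conn a a'.
have sizes : size s <= 3 * tau.
  by have := up_path_rank up_s; rewrite -ls da /j; lia.
have sizes' : size s' <= 3 * tau.
  by have := up_path_rank up_s'; rewrite -ls' da' dl /j; lia.
exists (s1 ++ g ++ s'); split.
- by rewrite !cat_path es1 ls1 eg lg up_path_edge.
- by rewrite !last_cat ls1 lg.
- by rewrite !size_cat ss1 sg; lia.
- move=> z; rewrite !mem_cat => /or3P[/sub1/ds/andP[]//|gz|s'z]; last first.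
    by have /andP[] : j <= d z <= d p by rewrite ds' // inE s'z orbT.
  (* Outside the root case, [a] is [3 * tau] layers closer to the root than [p], and [z] is within
     [3 * tau] of [a]. *)
  case/splitPr: g / gz eg lg sg => g1 g2; rewrite -cat_rcons cat_path => /andP[eg1 _] _ sg.
  have dz := dist_triangle e_conn r a z.
  have := dist_le_path eg1; rewrite last_rcons.
  rewrite size_cat in sg; rewrite da in dz.
  by have [/root|] := ltnP (d p) (3 * tau); rewrite /j in dz *; lia.
Qed.

End Layers.

(** * Balanced choice of a query *)

Lemma leq_card_bigcup (I T : finType) (P : pred I) (B : I -> {set T}) :
  #|\bigcup_(i | P i) B i| <= \sum_(i | P i) #|B i|.
Proof.
elim/big_rec2: _ => [|i m A _ IH]; first by rewrite cards0.
by apply: leq_trans (leq_card_setU _ _) _; rewrite leq_add2l.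
Qed.

Definition below (V : finType) (g : rel V) (x : V) : {set V} :=
  [set w | connect g x w].

Section Balance.
Variables (V : finType) (e : rel V) (r : V).
Hypothesis e_graph : simple_connected_graph e.
Local Notation d := (dist e r).
Local Notation up := (upward e d).

Lemma leq_degree (g : rel V) x : subrel g e -> #|[set y | g x y]| <= maxdeg e.
Proof.
move=> sub; apply: leq_trans (leq_bigmax x).
by apply: subset_leq_card; apply/subsetP => y; rewrite !inE; exact: sub.
Qed.

(* The deepest [x] with more than half of [K] below it has at most [maxdeg e]
   children, each with at most half of [K] below it; the best of them works. *)
Lemma balanced_query (K : {set V}) x0 i :
    {in K, forall w, d w = i /\ connect up x0 w} -> 1 < #|K| ->
  exists y, [/\ connect up x0 y, 2 * #|K :&: below up y| <= #|K|
              & #|K| <= 2 * maxdeg e * #|K :&: below up y|].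
Proof.
move=> Ki K1; pose big x := connect up x0 x && (#|K| < 2 * #|K :&: below up x|).
have big0 : big x0.
  rewrite /big connect0 (setIidPl _) /=; first by lia.
  by apply/subsetP => w /Ki[_]; rewrite inE.
have [x /andP[x0x xK] xmax] := @arg_maxnP V x0 big d big0.
have children y : up x y -> 2 * #|K :&: below up y| <= #|K|.
  move=> xy; rewrite leqNgt; apply/negP => yK.
  have /xmax : big y by rewrite /big yK (connect_trans x0x (connect1 xy)).
  by case/andP: xy => _ /eqP-> /=; rewrite ltnn.
have [/existsP[y /andP[xy Ky]]|none] :=
    boolP [exists y, up x y && (#|K| <= 2 * maxdeg e * #|K :&: below up y|)].
  by exists y; split; [exact: connect_trans x0x (connect1 xy) | exact: children |].
exfalso.
have cover : K :&: below up x \subset \bigcup_(y | up x y) (K :&: below up y).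
  apply/subsetP => w /setIP[Kw]; rewrite inE => xw.
  have [dw _] := Ki w Kw.
  (* [K] lies in one layer, so if [x] were in [K] it would be the only member below [x], which is
     not more than half of [K]. *)
  have [wx|xw'] := eqVneq x w.
    have : K :&: below up x \subset [set x].
      apply/subsetP => z /setIP[Kz]; rewrite !inE => xz.
      have [dz _] := Ki z Kz.
      by rewrite (connect_up_eq e_graph xz) // wx dw dz.
    by move/subset_leq_card; rewrite cards1; lia.
  case/connectP: xw xw' => -[|y p] /= up_p lw; first by rewrite lw eqxx.
  case/andP: up_p => xy yp _; apply/bigcupP; exists y => //.
  by rewrite inE Kw inE; apply/connectP; exists p.
have leS := leq_trans (subset_leq_card cover) (leq_card_bigcup _ _).
have : \sum_(y | up x y) 2 * maxdeg e * #|K :&: below up y| <= \sum_(y | up x y) #|K|.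
  apply: leq_sum => y xy; move/existsPn/(_ y): none.
  by rewrite xy /= -ltnNge; exact: ltnW.
have : \sum_(y | up x y) 2 * #|K :&: below up y| <= \sum_(y | up x y) #|K|.
  exact: leq_sum.
rewrite -!big_distrr /= !sum_nat_const.
have : #|up x| <= maxdeg e.
  rewrite -(cardsE (up x)); apply: leq_trans (@leq_degree up x _); last by move=> a b /andP[].
  by apply: subset_leq_card; apply/subsetP => y; rewrite !inE.
move: leS xK; set S := \sum_(y | _) _; set c := #|_ :&: below up x|.
case: #|up x| => [|ch]; first by lia.
move=> cS kc chD _ kS.
have : 2 * maxdeg e * c <= maxdeg e * #|K|.
  apply: leq_trans (leq_trans kS _); first by rewrite leq_mul2l cS orbT.
  by rewrite leq_mul2r chD orbT.
by rewrite mulnAC [_ * maxdeg e]mulnC leq_pmul2l; lia.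
Qed.

End Balance.

(** * Balls in a subgraph *)

Section Ball.
Variables (V : finType) (g : rel V).

Definition nbhd (A : {set V}) := A :|: [set y | [exists x in A, g x y]].
(** Iteration never leaves the component of [p], whereas a ball cut out by [dist g] with radius at
    least [#|V|] would take in unreachable vertices. *)
Definition gball R p := iter R nbhd [set p].

Lemma path_in_gball p l R : path g p l -> size l <= R -> last p l \in gball R p.
Proof.
rewrite /gball; move: [set p] (set11 p) => A.
elim: R p l A => [|R IHR] p [|y l] A Ap //=; rewrite -iterS iterSr.
  by move=> _ _; apply: (IHR p [::]) => //; rewrite !inE Ap.
move=> /andP[py yl] sl; apply: IHR => //.
by rewrite !inE; apply/orP; right; apply/exists_inP; exists p.
Qed.

Lemma gball_sub (S : {pred V}) R p :
  (forall x y, g x y -> y \in S) -> p \in S -> {subset gball R p <= S}.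
Proof.
move=> gS Sp; elim: R => [|R IHR] y; first by rewrite inE => /eqP->.
by rewrite /= !inE => /orP[/IHR//|/exists_inP[x _ /gS]].
Qed.

Lemma card_gball m R p : (forall x, #|[set y | g x y]| <= m) ->
  #|gball R p| <= m.+1 ^ R.
Proof.
move=> deg; elim: R => [|R IHR]; first by rewrite cards1.
rewrite expnS mulSn.
have sub : [set y | [exists x in gball R p, g x y]] \subset
           \bigcup_(x in gball R p) [set y | g x y].
  apply/subsetP => y; rewrite inE => /exists_inP[x Bx xy].
  by apply/bigcupP; exists x; rewrite ?inE.
apply: leq_trans (leq_card_setU _ _) _; apply: leq_add => //.
apply: leq_trans (subset_leq_card sub) _; apply: leq_trans (leq_card_bigcup _ _) _.
apply: leq_trans (_ : \sum_(x in gball R p) m <= _).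
  by apply: leq_sum => x _; exact: deg.
by rewrite sum_nat_const mulnC leq_mul2l IHR orbT.
Qed.

End Ball.

(** With [a] candidates below the queried vertex and [b] elsewhere, either answer leaves at most the
    fraction [q.-1 / q], written without division. *)
Lemma balanced_split a b k q :
  a + b = k -> 2 * a <= k -> k <= q * a -> maxn a b * q <= k * q.-1.
Proof.
move=> <- le_ab le_q; have /maxn_idPr-> : a <= b by lia.
by rewrite -subn1 mulnBr muln1 mulnDl leq_subRL; nia.
Qed.

(** * The algorithm as a decision tree *)

Section Algorithm.
Variable n : nat.
Local Notation V := 'I_n.
Implicit Types (g h : rel V) (rk : V -> nat).

(** The continuation receives all answers as one function. Its default 0 is never mistaken for
    adjacency, which is tested as distance 1. *)
Fixpoint ask_row (u : V) (s : seq V) (k : (V -> nat) -> QTree n) : QTree n :=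
  if s is x :: s' then
    Ask u x (fun c => ask_row u s' (fun a => k (fun y => if y == x then c else a y)))
  else k (fun=> 0).

(** The candidates left in the worse case. Minimising this needs no knowledge of the maximum degree,
    which the algorithm is not given. *)
Definition split_size h (K : {set V}) y := maxn #|K :&: below h y| #|K :\: below h y|.

(* The test succeeds iff [y] is on a geodesic from the root to [v], that is, iff
   some parent of [v] lies below [y]. *)
Fixpoint search fuel h rk (v x : V) (W : {set V}) (k : V -> QTree n) : QTree n :=
  let K := W :&: below h x in
  if fuel is m.+1 then
    if #|K| <= 1 then k (odflt x [pick w in K]) else
    let y := [arg min_(y < x | connect h x y) split_size h K y] in
    Ask y v (fun c => if rk y + c == rk v then search m h rk v y W k
                      else search m h rk v x (W :\: below h y) k)
  else k x.

(* [g] is the subgraph induced by the vertices outside the queue. *)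
Fixpoint build R rk (r : V) (queue : seq V) g : QTree n :=
  if queue is v :: queue' then
    if rk v == 0 then build R rk r queue' g else
    search n (upward g rk) rk v r [set w | (rk w).+1 == rk v] (fun p =>
      ask_row v (enum (gball g R p)) (fun a =>
        build R rk r queue'
          [rel x y | [|| g x y, (x == v) && (a y == 1) | (y == v) && (a x == 1)]]))
  else Leaf g.

(** * Correctness and query count *)

Definition runs (A : QTree n) (o : V -> V -> nat) (E : rel V) (c : nat) : Prop :=
  (forall u v, (run A o).1 u v = E u v) /\ (run A o).2 <= c.

Lemma runs_leq A o E c c' : c <= c' -> runs A o E c -> runs A o E c'.
Proof. by move=> le_c [? ?]; split=> //; apply: leq_trans le_c. Qed.

Lemma ask_row_runs u s k o E c :
    (forall a, {in s, a =1 o u} -> (forall x, x \notin s -> a x = 0) ->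
       runs (k a) o E c) ->
  runs (ask_row u s k) o E (size s + c).
Proof.
elim: s k => [|x s IHs] k Hk /=; first exact: Hk.
have [|H1 H2] := IHs (fun a => k (fun y => if y == x then o u x else a y)); last by split.
move=> a as_ a0; apply: Hk => y; rewrite inE.
  by have [->//|_ /as_] := eqVneq y x.
by have [//|_ /a0] := eqVneq y x.
Qed.

Variables (e : rel V) (r : V).
Hypothesis e_graph : simple_connected_graph e.
Let e_sym : symmetric e. Proof. by case: e_graph. Qed.
Let e_irr : irreflexive e. Proof. by case: e_graph. Qed.
Let e_conn u v : connect e u v. Proof. by case: e_graph. Qed.
Local Notation d := (dist e r).
Local Notation up := (upward e d).
Local Notation q := (2 * maxdeg e).

(** All parents of [v] stay in [W] and one of them stays below [x]; as [m] bounds the number of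
    candidates, the fuel suffices. The inequality in [t] says that [t] reductions by the factor
    [q.-1 / q] leave fewer than two candidates. *)
Lemma search_runs h rk v k E c m x W t :
    rk =1 d -> (forall y w, d w < d v -> connect h y w = connect up y w) ->
    (forall p, up p v -> runs (k p) (dist e) E c) ->
    #|W :&: below h x| <= m -> d x < d v ->
    (forall p, up p v -> p \in W) -> {in W, forall w, (d w).+1 = d v} ->
    (exists2 p, up p v & connect up x p) ->
    #|W :&: below h x| * q.-1 ^ t < 2 * q ^ t ->
  runs (search m h rk v x W k) (dist e) E (t + c).
Proof.
move=> rkE hE Hk; elim: m x W t => [|m IHm] x W t.
  move=> + dx Wpar Wd [p pv xp]; rewrite leqn0 cards_eq0 => /eqP/setP/(_ p).
  have Wp := Wpar p pv.
  by rewrite !inE Wp hE ?xp // -(Wd p Wp).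
move=> leK dx Wpar Wd [p pv xp] lt_t /=.
set K := W :&: below h x in leK lt_t *.
have hEW w y : w \in W -> connect h y w = connect up y w.
  by move=> Ww; apply: hE; rewrite -(Wd w Ww).
have Kp : p \in K by rewrite !inE Wpar //= hEW ?Wpar.
case: leqP => [K1|K1].
  apply: runs_leq (leq_addl _ _) _; apply: Hk.
  case: pickP => [w Kw|/(_ p)]; last by rewrite Kp.
  by rewrite /= (card_le1_eqP K1 p w).
have [|z [xz Kz2 Kzq]] := @balanced_query V e r e_graph K x (d v).-1 _ K1.
  by move=> w /setIP[Ww]; rewrite inE hEW // -(Wd w Ww).
have belowE y : K :&: below h y = K :&: below up y.
  by apply/setP => w; rewrite !inE; case: (boolP (w \in W)) => //= Ww; rewrite !hEW.
have lt_below y w : w \in K -> connect h y w -> d y < d v.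
  case/setIP=> Ww _; rewrite hEW // => /(connect_up_le e_graph) le_yw.
  by rewrite -(Wd w Ww) ltnS.
rewrite -belowE in Kz2 Kzq.
have dz : d z < d v.
  have /card_gt0P[w /setIP[Kw]] : 0 < #|K :&: below h z|.
    by rewrite lt0n; apply: contraTneq Kzq => ->; rewrite muln0 -ltnNge ltnW.
  by rewrite inE; exact: lt_below.
have split_z : split_size h K z * q <= #|K| * q.-1 :=
  balanced_split (cardsID _ _) Kz2 Kzq.
(* [z] is only a benchmark: the chosen [y] splits at least as well. *)
have [y xy ymin] := arg_minnP (split_size h K) (connect0 h x).
have lt_split : split_size h K y * q <= #|K| * q.-1.
  apply: leq_trans split_z; rewrite leq_mul2r ymin ?orbT //.
  by rewrite hE.
have q0 : 0 < q.
  by rewrite lt0n; apply: contraTneq Kzq => ->; rewrite mul0n -ltnNge ltnW.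
have [le1 le2] : #|K :&: below h y| <= split_size h K y /\
                 #|K :\: below h y| <= split_size h K y.
  by split; [exact: leq_maxl | exact: leq_maxr].
have ltK : split_size h K y < #|K|.
  rewrite -(ltn_pmul2r q0); apply: leq_ltn_trans lt_split _.
  by rewrite ltn_pmul2l ?ltn_predL // ltnW.
(* Were no candidate below [y], the other part would be all of [K], against [ltK]. *)
have dy : d y < d v.
  have /card_gt0P[w /setIP[Kw]] : 0 < #|K :&: below h y|.
    by rewrite -(ltn_add2r #|K :\: below h y|) add0n cardsID (leq_ltn_trans le2).
  by rewrite inE; exact: lt_below.
case: t lt_t => [|t] lt_t; first by rewrite !expn0 !muln1 ltnS leqNgt K1 in lt_t.
have next k' : k' <= split_size h K y -> k' * q.-1 ^ t < 2 * q ^ t.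
  move=> le_k'; rewrite -(ltn_pmul2r q0) -[2 * _ * _]mulnA -expnSr mulnAC.
  apply: leq_ltn_trans lt_t; rewrite expnS [leqRHS]mulnA leq_mul2r; apply/orP; right.
  by apply: leq_trans lt_split; rewrite leq_mul2r le_k' orbT.
suff H : runs (if rk y + dist e y v == rk v then search m h rk v y W k
               else search m h rk v x (W :\: below h y) k) (dist e) E (t + c).
  by case: H => H1 H2; split.
rewrite !rkE -(connect_upE r e_graph); rewrite hE // in xy.
case: ifP => [yv|nyv].
  have KE : W :&: below h y = K :&: below h y.
    apply/setP => w; rewrite !inE; case: (boolP (w \in W)) => //= Ww.
    rewrite !hEW //; case yw: (connect up y w); rewrite ?andbF // andbT.
    by rewrite (connect_trans xy yw).
  apply: IHm => //; rewrite ?KE.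
  - by rewrite -ltnS (leq_trans _ leK) // (leq_ltn_trans le1).
  - have [|p' yp' p'v] := connect_up_parent yv; last by exists p'.
    by apply: contraTneq dy => ->; rewrite ltnn.
  - exact: next.
have KE : (W :\: below h y) :&: below h x = K :\: below h y.
  by apply/setP => w; rewrite !inE andbA.
apply: IHm => //; rewrite ?KE.
- by rewrite -ltnS (leq_trans _ leK) // (leq_ltn_trans le2).
(* After a negative answer no parent of [v] is below [y], since otherwise [v] would be too. *)
- move=> p' p'v; rewrite !inE Wpar // andbT hEW ?Wpar //.
  by apply: contraFN nyv => yp'; apply: connect_trans yp' (connect1 p'v).
- by move=> w /setDP[Ww _]; exact: Wd.
- by exists p.
- exact: next.
Qed.

Variable tau : nat.
Hypothesis tl : treelength_le e tau.
Local Notation R := (9 * tau).+1.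

Section Step.
Variables (rk : V -> nat) (v : V) (queue : seq V) (g : rel V).
Hypothesis gE : forall x y, g x y = [&& e x y, x \notin v :: queue & y \notin v :: queue].
Hypothesis rkE : rk =1 d.
Hypothesis done_le : forall x, x \notin v :: queue -> d x <= d v.
Hypothesis queue_ge : {in queue, forall y, d v <= d y}.

Lemma lower_done x : d x < d v -> x \notin v :: queue.
Proof.
rewrite inE; apply: contraL => /predU1P[->|/queue_ge]; first by rewrite ltnn.
by rewrite -leqNgt.
Qed.

(** Upward paths to [w] visit only layers before that of [v], whose vertices have all left the
    queue. *)
Lemma connect_upward_known y w :
  d w < d v -> connect (upward g rk) y w = connect up y w.
Proof.
move=> dw; apply/idP/idP.
  apply: connect_sub => a b; rewrite /upward /= gE !rkE => /andP[/and3P[ab _ _] dab].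
  by apply: connect1; rewrite /upward /= ab.
case/connectP => p up_p lw; apply/connectP; exists p => //.
have Sp : all [predC v :: queue] (y :: p).
  apply/allP => z /(up_path_mem up_p)[_ /(connect_up_le e_graph)].
  by rewrite -lw => /leq_ltn_trans/(_ dw)/lower_done.
apply: (sub_in_path _ Sp up_p) => a b Sa Sb /andP[ab dab].
by rewrite /upward /= gE !rkE ab dab andbT /=; apply/andP.
Qed.

(** A processed neighbour [w] lies in the layer of [p] or of [v]. Either way [low_path] starts from
    a short walk through [v] and returns a path in layers up to that of [p], all known, hence a path
    in [g]. *)
Lemma neighbor_in_gball p w :
  up p v -> e v w -> w \notin v :: queue -> w \in gball g R p.
Proof.
case/andP=> pv /eqP dv vw Sw.
have dpv : d p < d v by rewrite dv.
have low l : path e p l -> {in l, forall z, d z <= d p} -> path g p l.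
  move=> ep dl; have Sl : all [predC v :: queue] (p :: l).
    apply/allP => z pz; apply: lower_done; apply: leq_ltn_trans dpv.
    by move: pz; rewrite inE => /predU1P[->|/dl].
  by apply: (sub_in_path _ Sl ep) => a b Sa Sb ab; rewrite gE ab /=; apply/andP.
have dwv := done_le Sw.
have dvw : d v <= (d w).+1 by apply: (rank_edge _ e_graph); rewrite e_sym.
have [dw|dw] := eqVneq (d w) (d p).
  have [|||l [ep lw sl dl]] := @low_path V e r e_graph tau tl p [:: v; w].
  - by rewrite /= pv vw.
  - by move=> z; rewrite !inE => /orP[]/eqP->; rewrite ?dw // dv.
  - exact: dw.
  by rewrite -[w]/(last p [:: v; w]) -lw; apply: path_in_gball (low _ ep dl) (leqW sl).
have dwE : d w = d v.
  by apply/eqP; rewrite eqn_leq dwv dv ltn_neqAle eq_sym dw -ltnS -dv.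
have [|p' p'w] := @exists_parent V e r e_graph w; first by rewrite dwE dv.
have /andP[ep'w /eqP dp'w] := p'w.
have dp' : d p' = d p by apply/eqP; rewrite -eqSS -dp'w dwE dv.
(* Here [w] is level with [v]; the final edge from its parent [p'] accounts for the extra 1 in
   [R]. *)
have [|||l [ep lw sl dl]] := @low_path V e r e_graph tau tl p [:: v; w; p'].
- by rewrite /= pv vw e_sym ep'w.
- by move=> z; rewrite !inE => /or3P[]/eqP->; rewrite ?dp' ?dwE ?dv.
- exact: dp'.
rewrite -(last_rcons p l w); apply: path_in_gball; last by rewrite size_rcons ltnS.
by rewrite rcons_path low // lw /= gE ep'w Sw andbT lower_done // dp'.
Qed.

End Step.

(** Induction on the queue, sorted by distance from the root. Each vertex costs at most [t] queries
    to find a parent and [(maxdeg e).+1 ^ R] for the ball around that parent. *)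
Lemma build_runs rk t queue g :
    rk =1 d -> n * q.-1 ^ t < 2 * q ^ t ->
    (forall x y, g x y = [&& e x y, x \notin queue & y \notin queue]) ->
    uniq queue -> sorted (relpre rk leq) queue ->
    (forall x y, x \notin queue -> y \in queue -> d x <= d y) ->
  runs (build R rk r queue g) (dist e) e (size queue * (t + (maxdeg e).+1 ^ R)).
Proof.
move=> rkE lt_t; elim: queue g => [|v queue IHq] g gE /=.
  by move=> _ _ _; split=> // x y; rewrite /= gE !andbT.
move=> /andP[vq Uq] sq done_le.
have queue_ge : {in queue, forall y, d v <= d y}.
  have tr : transitive (relpre rk leq) by move=> a b c; exact: leq_trans.
  by move=> y qy; have := order_path_min tr sq => /allP/(_ y qy) /=; rewrite !rkE.
have v_ge x : x \notin v :: queue -> d x <= d v.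
  by move=> /done_le; apply; exact: mem_head.
have done_le' x y : x \notin queue -> y \in queue -> d x <= d y.
  move=> xq yq; have [->|xv] := eqVneq x v; first exact: queue_ge.
  by apply: done_le; rewrite inE ?yq ?orbT // negb_or xv.
have sq' := path_sorted sq.
(* Rank 0 means that [v] is the root. Vertices outside the queue then also have distance 0, so [v]
   is alone and there is no edge to add. *)
rewrite [_.+1 * (t + _)]mulSn; case: eqP => [v0|v0].
  apply: runs_leq (leq_addl _ _) _; apply: IHq => // x y; rewrite gE.
  rewrite !inE !negb_or; case exy: (e x y) => //=.
  rewrite rkE in v0.
  have alone z : z \notin queue -> z = v.
    move=> zq; have [//|zv] := eqVneq z v.
    have := v_ge z; rewrite inE negb_or zv zq v0 leqn0 => /(_ isT)/eqP z0.
    by rewrite -(dist_eq0 e_conn z0) -(dist_eq0 e_conn v0).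
  have [xq|] := boolP (x \in queue); first by rewrite !andbF.
  have [yq|] := boolP (y \in queue); first by rewrite !andbF.
  by move=> /alone yv /alone xv; rewrite xv yv e_irr in exy.
have dv : 0 < d v by rewrite lt0n -rkE; apply/eqP.
rewrite -addnA; apply: search_runs => //.
- exact: connect_upward_known.
- move=> p pv.
  have gball_done : {subset gball g R p <= [predC v :: queue]}.
    apply: gball_sub => [x y|]; first by rewrite gE => /and3P[].
    by apply: (lower_done queue_ge); case/andP: pv => _ /eqP->.
  have gball_le : #|gball g R p| <= (maxdeg e).+1 ^ R.
    apply: card_gball => x; apply: leq_degree => a b; by rewrite gE => /and3P[].
  apply: runs_leq (_ : size (enum (gball g R p)) +
                         size queue * (t + (maxdeg e).+1 ^ R) <= _) _.
    by rewrite -cardE leq_add2r.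
  apply: ask_row_runs => a aE a0; apply: IHq => // x y.
  (* The default 0 is right for unqueried vertices: [neighbor_in_gball] puts every processed
     neighbour of [v] in the ball. *)
  have vE z : z != v -> z \notin queue -> (a z == 1) = e v z.
    move=> zv zq; have zvq : z \notin v :: queue by rewrite inE negb_or zv.
    have [Bz|Bz] := boolP (z \in gball g R p).
      by rewrite aE ?mem_enum // dist_eq1.
    rewrite a0 ?mem_enum //; apply/esym/negbTE; apply: contra Bz => vz.
    exact: (neighbor_in_gball gE v_ge queue_ge pv).
  have vq0 z : z \in v :: queue -> a z == 1 = false.
    move=> zq; rewrite a0 // mem_enum; apply: contraL zq; exact: gball_done.
  rewrite /= gE !inE !negb_or.
  have [->|xv] := eqVneq x v; have [->|yv] := eqVneq y v; rewrite /= ?orbF ?andbF ?andbT /=.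
  + by rewrite e_irr vq0 // mem_head.
  + have [yq|yq] := boolP (y \in queue); first by rewrite vq0 ?andbF // inE yq orbT.
    by rewrite vE // vq !andbT.
  + have [xq|xq] := boolP (x \in queue); first by rewrite vq0 ?andbF // inE xq orbT.
    by rewrite vE // vq !andbT e_sym.
  + by [].
- by apply: leq_trans (max_card _) _; rewrite card_ord.
- by rewrite distxx.
- by move=> p /andP[_ /eqP dp]; rewrite inE !rkE dp.
- by move=> w; rewrite inE !rkE => /eqP.
- by have [p pv] := exists_parent e_graph dv; exists p => //; exact: connect_up_root.
- apply: leq_ltn_trans lt_t; rewrite leq_mul2r; apply/orP; right.
  by apply: leq_trans (max_card _) _; rewrite card_ord.
Qed.

End Algorithm.

(** * The logarithmic bound and the final assembly *)

(* Bernoulli: [(q - 1) ^ q <= q ^ q / 2]. *)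
Lemma halving q k : 1 < q -> 2 ^ k * q.-1 ^ (q * k) <= q ^ (q * k).
Proof.
case: q => // p; rewrite /= ltnS => p0.
suff base : 2 * p ^ p.+1 <= p.+1 ^ p.+1.
  by rewrite !expnM -expnMn; case: k => [|k]; rewrite ?expn0 // leq_exp2r.
(* Two terms of the binomial expansion; at [m = p] each is at least [p ^ p.+1]. *)
have bernoulli m : p ^ m.+1 + m.+1 * p ^ m <= p.+1 ^ m.+1.
  elim: m => [|m IHm]; first by rewrite !expn1 expn0 muln1 addn1.
  rewrite [leqRHS]expnS; apply: leq_trans (leq_mul (leqnn p.+1) IHm).
  by rewrite !expnS; move: (p ^ m) => x; nia.
by apply: leq_trans (bernoulli p); rewrite !expnS; nia.
Qed.

Theorem theorem1 :
  exists (A : forall n : nat, nat -> QTree n) (f : nat -> nat -> nat),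
    forall (n : nat) (e : rel 'I_n) (tau : nat),
      2 <= n ->
      simple_connected_graph e ->
      treelength_le e tau ->
      (forall u v : 'I_n, (run (A n tau) (dist e)).1 u v = e u v) /\
      (run (A n tau) (dist e)).2 <= f (maxdeg e) tau * n * trunc_log 2 n.
Proof.
exists (fun n tau =>
  if n is m.+1 return QTree n then
    ask_row ord0 (enum 'I_m.+1) (fun rk =>
      build (9 * tau).+1 rk ord0 (sort (relpre rk leq) (enum 'I_m.+1)) (fun _ _ => false))
  else Leaf (fun _ _ => false)).
(* The 1 pays for the root queries, [4 * D] for the searches, as [2 * D * L.+1 <= 4 * D * L] when
   [L > 0], and the power for the balls. *)
exists (fun D tau => (1 + 4 * D + D.+1 ^ (9 * tau).+1)).
move=> [//|m] e tau n2 e_graph tl.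
set n := m.+1 in e n2 e_graph tl *; set L := trunc_log 2 n; set D := maxdeg e.
(* Two vertices and connectedness give the root a neighbour; [halving] needs [1 < 2 * D]. *)
have D0 : 0 < D.
  have [_ _ e_conn] := e_graph.
  have /connectP[[|y p] /=] := e_conn (ord0 : 'I_n) (inord 1).
    by move=> _ /(congr1 val); rewrite /= inordK.
  case/andP=> y0 _ _; apply: leq_trans (leq_bigmax (ord0 : 'I_n)).
  by apply/card_gt0P; exists y; rewrite inE.
(* Every [2 * D] queries halve the candidates, and [n < 2 ^ L.+1]. *)
pose t := 2 * D * L.+1; pose B := D.+1 ^ (9 * tau).+1.
have lt_t : n * (2 * D).-1 ^ t < 2 * (2 * D) ^ t.
  have q1 : 1 < 2 * D by lia.
  have := halving L.+1 q1; rewrite -/t => le_t.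
  have lt_n : n < 2 ^ L.+1 by rewrite trunc_log_ltn.
  have q0 : 0 < (2 * D) ^ t by rewrite expn_gt0; lia.
  apply: leq_ltn_trans (_ : (2 * D) ^ t < _); last by lia.
  by apply: leq_trans le_t; rewrite leq_mul2r (ltnW lt_n) orbT.
have L0 : 0 < L by rewrite trunc_log_gt0 n2.
suff : runs (ask_row (ord0 : 'I_n) (enum 'I_n) (fun rk =>
          build (9 * tau).+1 rk ord0 (sort (relpre rk leq) (enum 'I_n)) (fun _ _ => false)))
        (dist e) e (size (enum 'I_n) + n * (t + B)).
  rewrite size_enum_ord => -[H1 H2]; split=> //; apply: leq_trans H2 _; rewrite /t; nia.
apply: ask_row_runs => rk rkE _.
set queue := sort _ _.
have in_queue (x : 'I_n) : x \in queue by rewrite mem_sort mem_enum.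
have -> : n * (t + B) = size queue * (t + B) by rewrite size_sort size_enum_ord.
apply: build_runs => //.
- by move=> x; apply: rkE; rewrite mem_enum.
- by move=> x y; rewrite in_queue andbF.
- by rewrite sort_uniq enum_uniq.
- by apply: sort_sorted => x y; exact: leq_total.
- by move=> x y; rewrite in_queue.
Qed.
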